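(* Fix an integer $n\ge2$ and let $R=\mathbb Z[x,y,z,\{t_m\mid m\in\binom{x,y,z}{2n-2}\}]$. Let $T=(t_{m_1m_2})_{m_1,m_2\in\binom{x,y,z}{n-1}}$, let $\boldsymbol\delta=\det T$, let $Q=(Q_{m_1,m_2})$ be the classical adjoint of $T$, and for $m_2\in\binom{x,y,z}{n-1}$ let $\lambda_{m_2}=\sum_{m_1\in\binom{x,y,z}{n-1}}m_1Q_{m_1,m_2}\in R$. For a statement $P$ let $\chi(P)=1$ if $P$ is true and $\chi(P)=0$ otherwise (a term with factor $\chi(P)$ is zero when $P$ is false). Then the differentials of the complex $$(\mathbb B,b):\quad 0\to R\xrightarrow{b_3}R\otimes_{\mathbb Z}(\operatorname{Sym}_{n-1}^{\mathbb Z}U_0\oplus D_n^{\mathbb Z}(U_0^* ))\xrightarrow{b_2}R\otimes_{\mathbb Z}(D_{n-1}^{\mathbb Z}(U_0^* )\oplus\operatorname{Sym}_n^{\mathbb Z}U_0)\xrightarrow{b_1}R$$ defined in the context are given by the following formulas. (1) $b_1(1\otimes m^* )=x\lambda_m$ for $m\in\binom{y,z}{n-1}$, and $b_1(1\otimes m)=\boldsymbol\delta m-x\sum_{m_1\in\binom{x,y,z}{n-2}}\lambda_{xm_1}t_{m_1m}$ for $m\in\binom{y,z}{n}$. (2)(a) If $m_2\in\binom{y,z}{n-1}$, then $$\begin{aligned}b_2(1\otimes m_2)=&\sum_{m_1\in\binom{y,z}{n-1}}\ \sum_{M_1,M_2\in\binom{x,y,z}{n-2}}xQ_{xM_1,xM_2}\det\begin{bmatrix}t_{m_1M_1y}&t_{m_1M_1z}\\t_{m_2M_2y}&t_{m_2M_2z}\end{bmatrix}\otimes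 m_1^*\\&+\sum_{m_1\in\binom{y,z}{n}}\ \sum_{M\in\binom{x,y,z}{n-2}}x\Big[\chi(y|m_1)Q_{\frac{m_1}y,xM}t_{Mm_2z}-\chi(z|m_1)Q_{\frac{m_1}z,xM}t_{Mm_2y}\Big]\otimes m_1\\&+y\boldsymbol\delta\otimes zm_2-z\boldsymbol\delta\otimes ym_2.\end{aligned}$$ (2)(b) If $m_2\in\binom{y,z}{n}$, then $$\begin{aligned}b_2(1\otimes m_2^* )=&\ \chi(z|m_2)\Big[\sum_{m'\in\binom{x,y,z}{n-2}}\sum_{M\in\binom{y,z}{n-1}}xt_{yMm'}Q_{xm',\frac{m_2}z}\otimes M^*-y\boldsymbol\delta\otimes\big(\tfrac{m_2}z\big)^*+\sum_{M\in\binom{y,z}{n-1}}xQ_{M,\frac{m_2}z}\otimes yM\Big]\\&-\chi(y|m_2)\Big[\sum_{m'\in\binom{x,y,z}{n-2}}\sum_{M\in\binom{y,z}{n-1}}xt_{zMm'}Q_{xm',\frac{m_2}y}\otimes M^*-z\boldsymbol\delta\otimes\big(\tfrac{m_2}y\big)^*+\sum_{M\in\binom{y,z}{n-1}}xQ_{M,\frac{m_2}y}\otimes zM\Big].\end{aligned}$$ (3) $$b_3(1)=\sum_{m\in\binom{y,z}{n-1}}b_1(1\otimes m^* )\otimes m+\sum_{m\in\binom{y,z}{n}}b_1(1\otimes m)\otimes m^*.$$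
   Context: For a set of variables and $N\ge0$, $\binom{x,y,z}{N}$ (resp. $\binom{y,z}{N}$) denotes the set of monomials of degree $N$ in $x,y,z$ (resp. in $y,z$). Let $U$ be a free $\mathbb Z$-module with basis $x,y,z$, and $U_0=\mathbb Zy\oplus\mathbb Zz$. $D_N^{\mathbb Z}(U^* )=\operatorname{Hom}_{\mathbb Z}(\operatorname{Sym}_N^{\mathbb Z}U,\mathbb Z)$, and $D_\bullet^{\mathbb Z}(U^* )$ is a $\operatorname{Sym}_\bullet^{\mathbb Z}U$-module by $[\mu(\nu)](\mu')=\nu(\mu\mu')$. For $m\in\binom{x,y,z}{N}$, $m^*\in D_N^{\mathbb Z}(U^* )$ is the dual basis element; $x_i(m^* )=(m/x_i)^*$ if $x_i$ divides $m$ and $0$ otherwise. If $\mu,\nu$ have the same degree, then $\mu(\nu)=\nu(\mu)\in\mathbb Z$. $D_N^{\mathbb Z}(U_0^* )$ is viewed inside $D_N^{\mathbb Z}(U^* )$ as the span of the $m^*$ with $m\in\binom{y,z}{N}$. Definition of $(\mathbb B,b)$. The ring $R=\mathbb Z[x,y,z,\{t_m\}]$ is $\operatorname{Sym}_\bullet^{\mathbb Z}(U\oplus\operatorname{Sym}_{2n-2}^{\mathbb Z}U)$ with $t_m$ the element $m$ of the summand $\operatorname{Sym}_{2n-2}^{\mathbb Z}U$. Let $\Psi:\operatorname{Sym}_\bullet^{\mathbb Z}U\to R$ be the inclusion of $\mathbb Z[x,y,z]$ (extended $R$-linearly to $R\otimes_{\mathbb Z}\operatorname{Sym}_\bullet^{\mathbb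 Z}U$), and $\Phi=\sum_{m\in\binom{x,y,z}{2n-2}}t_m\otimes m^*\in R\otimes D_{2n-2}^{\mathbb Z}(U^* )$. All maps are extended $R$-linearly as needed. Let $p:\operatorname{Sym}_{n-1}^{\mathbb Z}U\to R\otimes D_{n-1}^{\mathbb Z}(U^* )$, $p(\mu)=\mu(\Phi)$; its matrix in the monomial and dual bases is $T$. Let $q:D_{n-1}^{\mathbb Z}(U^* )\to R\otimes\operatorname{Sym}_{n-1}^{\mathbb Z}U$ be the classical adjoint of $p$, $q(m_2^* )=\sum_{m_1}Q_{m_1,m_2}\otimes m_1$, and $\mathfrak Q(\nu\otimes\nu')=[q(\nu)](\nu')\in R$. Let $\widetilde\Phi=\sum_{m\in\binom{x,y,z}{2n-2}}t_m\otimes(xm)^*\in R\otimes D_{2n-1}^{\mathbb Z}(U^* )$; it is the element with $x(\widetilde\Phi)=\Phi$ and $\mu(\widetilde\Phi)=0$ for all $\mu\in\operatorname{Sym}_{2n-1}^{\mathbb Z}U_0$. For $\mu,\mu'\in\operatorname{Sym}_{n-1}^{\mathbb Z}U_0$ and $\nu,\nu'\in D_n^{\mathbb Z}(U_0^* )$ set $$\beta_1(\nu\wedge\nu')=\Psi(x)[\mathfrak Q(z(\nu)\otimes y(\nu'))-\mathfrak Q(y(\nu)\otimes z(\nu'))],$$ $$\beta_2(\mu\otimes\nu)=\Psi(x)[\mathfrak Q((z\mu)(\widetilde\Phi)\otimes y(\nu))-\mathfrak Q((y\mu)(\widetilde\Phi)\otimes z(\nu))],$$ $$\beta_3(\mu\wedge\mu')=\Psi(x)[\mathfrak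 Q((z\mu)(\widetilde\Phi)\otimes(y\mu')(\widetilde\Phi))-\mathfrak Q((y\mu)(\widetilde\Phi)\otimes(z\mu')(\widetilde\Phi))].$$ Let $B_3=B_0=R$, $B_2=R\otimes_{\mathbb Z}(\operatorname{Sym}_{n-1}^{\mathbb Z}U_0\oplus D_n^{\mathbb Z}(U_0^* ))$, $B_1=B_2^*=R\otimes_{\mathbb Z}(D_{n-1}^{\mathbb Z}(U_0^* )\oplus\operatorname{Sym}_n^{\mathbb Z}U_0)$, and define $\mathfrak b:\bigwedge^2_{R}B_2\to R$ by $$\mathfrak b((\mu+\nu)\wedge(\mu'+\nu'))=\beta_3(\mu\wedge\mu')+\beta_2(\mu\otimes\nu')-\beta_2(\mu'\otimes\nu)+\beta_1(\nu\wedge\nu')+\Psi(y)\boldsymbol\delta([z\mu](\nu')-[z\mu'](\nu))-\Psi(z)\boldsymbol\delta([y\mu](\nu')-[y\mu'](\nu)).$$ Then $[b_2(\theta)](\theta')=\mathfrak b(\theta\wedge\theta')$ for $\theta,\theta'\in B_2$; $b_1(\nu)=\Psi(x)\Psi(q(\nu))$ for $\nu\in D_{n-1}^{\mathbb Z}(U_0^* )$; $b_1(\mu)=\boldsymbol\delta\,\Psi(\mu)-\Psi(x)\Psi(q(\mu(\widetilde\Phi)))$ for $\mu\in\operatorname{Sym}_n^{\mathbb Z}U_0$; and $b_3(1)=b_1$, viewed as an element of $B_1^*=B_2$. *)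

(* Defs.v *)
From HB Require Import structures.
From mathcomp Require Import all_boot all_order all_algebra.
From mathcomp Require Import ring.
From mathcomp.multinomials Require Import mpoly.

Set Implicit Arguments.
Unset Strict Implicit.
Unset Printing Implicit Defensive.

Import GRing.Theory.
Local Open Scope ring_scope.

Record mon (k N : nat) := Mon {
  mon_val :> 'X_{1..k};
  _ : mdeg mon_val == N }.

HB.instance Definition _ k N := [isSub for @mon_val k N].
HB.instance Definition _ k N := [Countable of mon k N by <:].

Lemma mon_deg k N (m : mon k N) : mdeg m = N.
Proof. by case: m => m /= /eqP. Qed.

Lemma mon_bdeg k N (m : mon k N) : (mdeg m < N.+1)%N.
Proof. by rewrite mon_deg. Qed.

Lemma mon_bmnmK k N :
  pcancel (fun m : mon k N => BMultinom (mon_bdeg m))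
          (fun m : 'X_{1..k < N.+1} => insub (bmnm m)).
Proof. by move=> m; rewrite /= valK. Qed.

HB.instance Definition _ k N : isFinite (mon k N) := PCanIsFinite (@mon_bmnmK k N).

(** ** Symmetric and divided powers over a commutative ring [A]

   For V free over Z on k generators, [dhomog k A N] is A (x) Sym_N V, and its
   A-dual 'Hom(dhomog k A N, A^o) is A (x) Hom(Sym_N V, Z) = A (x) D_N. *)

HB.lock Definition hpart (A : comNzRingType) (k N : nat) (p : {mpoly A[k.+1]}) :
    dhomog k.+1 A N :=
  ['dhomog_N (pihomog mdeg N p)].

Section Powers.
Context {A : comNzRingType} {k : nat}.
Local Notation Sym N := (dhomog k.+1 A N).
Local Notation hpart := (@hpart A k).
Local Notation Dp N := 'Hom(dhomog k.+1 A N, A^o).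
Implicit Types (N K : nat) (m : 'X_{1..k.+1}) (p : {mpoly A[k.+1]}).

Lemma val_hpart N p : hpart N p = pihomog mdeg N p :> {mpoly A[k.+1]}.
Proof. by rewrite hpart.unlock /indhomog -[LHS]/(val _) insubdK //; exact: pihomogP. Qed.

Lemma hpart_val N (f : Sym N) : hpart N f = f.
Proof. by apply: val_inj; rewrite /= val_hpart pihomog_dE ?dhomog_is_dhomog. Qed.

Lemma hpart_is_linear N : linear (hpart N).
Proof. by move=> c f g; apply: val_inj; rewrite /= !val_hpart linearP. Qed.

HB.instance Definition _ N :=
  GRing.isLinear.Build A {mpoly A[k.+1]} (Sym N) _ (hpart N) (hpart_is_linear N).

(* [mono m] and [dmono m] (the dual basis element m^* of m) are only meaningful
   for [mdeg m = N]; both are 0 otherwise. *)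
Definition mono N m : Sym N := hpart N 'X_[m].

Definition dmono N m : Dp N :=
  linfun (fun f : Sym N => (f : {mpoly A[k.+1]})@_m : A^o).

(* The component of [p (nu)] in degree [K]: it sends [f] to [nu (p * f)]. *)
Definition contract N K p (nu : Dp N) : Dp K :=
  linfun (fun f : Sym K => nu (hpart N (p * f))).

Lemma linfunE (V W : vectType A) (f : V -> W) :
  linear f -> forall v, linfun f v = f v.
Proof.
move=> f_lin v.
pose M := GRing.isLinear.Build A V W _ f f_lin.
pose F : {linear V -> W} := HB.pack f M.
exact: (lfunE F v).
Qed.

Lemma dmonoE N m (f : Sym N) : dmono N m f = (f : {mpoly A[k.+1]})@_m.
Proof.
by rewrite linfunE // => c g h; rewrite !linearP.
Qed.

Lemma contractE N K p (nu : Dp N) (f : Sym K) :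
  contract K p nu f = nu (hpart N (p * f)).
Proof.
by rewrite linfunE // => c g h; rewrite linearP /= mulrDr -scalerAr !linearP.
Qed.

Lemma contractC N K (nu : Dp N) (f g : Sym K) :
  contract K f nu g = contract K g nu f.
Proof. by rewrite !contractE mulrC. Qed.

Lemma contract_linear N K p : linear (@contract N K p).
Proof.
move=> c nu nu'; apply/lfunP => f.
by rewrite add_lfunE scale_lfunE !contractE add_lfunE scale_lfunE.
Qed.

Lemma contract_linearl N K (nu : Dp N) : linear (fun p => contract K p nu).
Proof.
move=> c p p'; apply/lfunP => f.
rewrite add_lfunE scale_lfunE !contractE mulrDl -scalerAl.
by rewrite !linearP.
Qed.

Lemma mono_eq0 N m : mdeg m != N -> mono N m = 0.
Proof.
by move=> mN; apply: val_inj; rewrite /= val_hpart pihomogX (negPf mN).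
Qed.

Lemma val_mono N m : mdeg m = N -> mono N m = 'X_[m] :> {mpoly A[k.+1]}.
Proof. by move=> mN; rewrite val_hpart pihomogX /= mN eqxx. Qed.

Lemma dhomog_mono N (f : Sym N) : f = \sum_(m : mon k.+1 N) (f : {mpoly A[k.+1]})@_m *: mono N m.
Proof.
apply: val_inj; rewrite linear_sum /=.
apply/mpolyP => m; rewrite linear_sum /=.
case: (boolP (mdeg m == N)) => [mN|mN]; last first.
  rewrite (dhomog_nemf_coeff (valP f) mN) big1 // => i _.
  rewrite val_mono ?mon_deg // mcoeffZ mcoeffX; case: eqP => [im|]; last by rewrite mulr0.
  by rewrite -im mon_deg eqxx in mN.
rewrite (bigD1 (Mon mN)) //= val_mono ?(eqP mN) // mcoeffZ mcoeffX eqxx mulr1.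
rewrite big1 ?addr0 // => i ine; rewrite val_mono ?mon_deg // mcoeffZ mcoeffX.
case: eqP => [im|]; last by rewrite mulr0.
by case/eqP: ine; apply: val_inj.
Qed.

Lemma dhomog_dmono N (nu : Dp N) :
  nu = \sum_(m : mon k.+1 N) nu (mono N m) *: dmono N m.
Proof.
apply/lfunP => f; rewrite [in LHS](dhomog_mono f) linear_sum sum_lfunE /=.
by apply: eq_bigr => m _; rewrite linearZ scale_lfunE dmonoE; apply: mulrC.
Qed.

End Powers.

(* Variables 0 and 1 of the three-variable polynomial rings are y and z and
   variable 2 is x, so that [mwiden] is the inclusion of Sym U_0 = Z[y,z] into
   Sym U. *)
Definition jy : 'I_2 := @Ordinal 2 0 isT.
Definition jz : 'I_2 := @Ordinal 2 1 isT.
Definition iy : 'I_3 := @Ordinal 3 0 isT.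
Definition iz : 'I_3 := @Ordinal 3 1 isT.
Definition ix : 'I_3 := @Ordinal 3 2 isT.

Definition nvars (n : nat) : nat := 3 + #|{: mon 3 (2 * n - 2)}|.

Definition Rn (n : nat) : comNzRingType := {mpoly int[nvars n]}.

Definition rvar n (i : 'I_3) : Rn n :=
  ('X_(lshift #|{: mon 3 (2 * n - 2)}| i) : {mpoly int[nvars n]}).

Definition rx n : Rn n := rvar n ix.
Definition ry n : Rn n := rvar n iy.
Definition rz n : Rn n := rvar n iz.

(* t_m, extended by 0 to the monomials whose degree is not 2n-2. *)
Definition t n (m : 'X_{1..3}) : Rn n :=
  if (insub m : option (mon 3 (2 * n - 2))) is Some m' then
    ('X_(rshift 3 (enum_rank m')) : {mpoly int[nvars n]})
  else 0.

Definition Tmx n : 'M[Rn n]_(#|{: mon 3 n.-1}|) :=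
  \matrix_(i, j) t n (mon_val (enum_val i) + mon_val (enum_val j))%MM.

Definition delta n : Rn n := \det (Tmx n).

(* Q_{m1,m2}, extended by 0 to monomials whose degree is not n-1. *)
Definition Q n (m1 m2 : 'X_{1..3}) : Rn n :=
  match (insub m1 : option (mon 3 n.-1)), (insub m2 : option (mon 3 n.-1)) with
  | Some a, Some b => (\adj (Tmx n)) (enum_rank a) (enum_rank b)
  | _, _ => 0
  end.

Section Maps.
Context {n : nat}.
Local Notation R := (Rn n).
(* Over R: Sym_N U, D_N of the dual of U, Sym_N U_0, D_N of the dual of U_0. *)
Local Notation S N := (dhomog 3 (Rn n) N).
Local Notation D N := 'Hom(dhomog 3 (Rn n) N, (Rn n)^o).
Local Notation S0 N := (dhomog 2 (Rn n) N).
Local Notation D0 N := 'Hom(dhomog 2 (Rn n) N, (Rn n)^o).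

Definition Psi (p : {mpoly R[3]}) : R := p.@[rvar n].

Definition lambda (m2 : 'X_{1..3}) : R :=
  \sum_(m1 : mon 3 n.-1) Psi 'X_[m1] * Q n m1 m2.

Definition Phi : D (2 * n - 2) :=
  \sum_(m : mon 3 (2 * n - 2)) t n m *: dmono (2 * n - 2) m.

Definition Phit : D (2 * n - 1) :=
  \sum_(m : mon 3 (2 * n - 2)) t n m *: dmono (2 * n - 1) (U_(ix) + m)%MM.

Definition p (mu : S n.-1) : D n.-1 := contract n.-1 mu Phi.

(* The matrix of [p]: entry (m1, m2) is the coefficient of m1^* in p(m2). *)
Definition pmx : 'M[R]_(#|{: mon 3 n.-1}|) :=
  \matrix_(i, j) p (mono n.-1 (mon_val (enum_val j))) (mono n.-1 (mon_val (enum_val i))).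

Definition q (nu : D n.-1) : S n.-1 :=
  \sum_(m1 : mon 3 n.-1) \sum_(m2 : mon 3 n.-1)
    (\adj pmx (enum_rank m1) (enum_rank m2) * nu (mono n.-1 m2)) *: mono n.-1 m1.

Definition fQ (nu nu' : D n.-1) : R := nu' (q nu).

(* D_N of the dual of U_0 as the span of the m^* with m a monomial in y and z. *)
Definition dwiden N (nu : D0 N) : D N :=
  \sum_(m : mon 2 N) nu (mono N m) *: dmono N (mnmwiden m).

(* z(nu), y(nu), (z mu)(Phi~), (y mu)(Phi~) *)
Definition zD (nu : D0 n) : D n.-1 := contract n.-1 'X_iz (dwiden nu).
Definition yD (nu : D0 n) : D n.-1 := contract n.-1 'X_iy (dwiden nu).

Definition zPhit (mu : S0 n.-1) : D n.-1 :=
  contract n.-1 ('X_iz * mwiden mu) Phit.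
Definition yPhit (mu : S0 n.-1) : D n.-1 :=
  contract n.-1 ('X_iy * mwiden mu) Phit.

Definition beta1 (nu nu' : D0 n) : R :=
  Psi 'X_ix * (fQ (zD nu) (yD nu') - fQ (yD nu) (zD nu')).

Definition beta2 (mu : S0 n.-1) (nu : D0 n) : R :=
  Psi 'X_ix * (fQ (zPhit mu) (yD nu) - fQ (yPhit mu) (zD nu)).

Definition beta3 (mu mu' : S0 n.-1) : R :=
  Psi 'X_ix * (fQ (zPhit mu) (yPhit mu') - fQ (yPhit mu) (zPhit mu')).

(* [i mu](nu) for a variable i of U_0 *)
Definition evar (i : 'I_2) (mu : S0 n.-1) (nu : D0 n) : R :=
  nu (hpart n ('X_i * mu)).

Definition B2 := (S0 n.-1 * D0 n)%type.
Definition B1 := (D0 n.-1 * S0 n)%type.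
HB.instance Definition _ := Vector.on B2.
HB.instance Definition _ := Vector.on B1.

(* The form on the exterior square of B_2, as an alternating bilinear map: see
   [bform_alt] and [bform_linearr]. *)
Definition bform (th th' : B2) : R :=
  let: (mu, nu) := th in let: (mu', nu') := th' in
  beta3 mu mu' + beta2 mu nu' - beta2 mu' nu + beta1 nu nu'
  + Psi 'X_iy * (delta n * (evar jz mu nu' - evar jz mu' nu))
  - Psi 'X_iz * (delta n * (evar jy mu nu' - evar jy mu' nu)).

Definition pairing (eta : B1) (th : B2) : R := eta.1 th.1 + th.2 eta.2.

(* The identifications of linear forms on B_2 with elements of B_1, and of linear
   forms on B_1 with elements of B_2, given by [pairing]: see [dualB2P], [dualB1P]. *)
Definition dualB2 (f : B2 -> R) : B1 :=
  (linfun (fun mu : S0 n.-1 => f (mu, 0) : R^o),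
   \sum_(m : mon 2 n) f (0, dmono n m) *: mono n m).
Definition dualB1 (g : B1 -> R) : B2 :=
  (\sum_(m : mon 2 n.-1) g (dmono n.-1 m, 0) *: mono n.-1 m,
   linfun (fun mu : S0 n => g (0, mu) : R^o)).

Definition b1 (eta : B1) : R :=
  let: (nu, mu) := eta in
  Psi 'X_ix * Psi (q (dwiden nu))
  + (delta n * Psi (mwiden mu)
     - Psi 'X_ix * Psi (q (contract n.-1 (mwiden mu) Phit))).

Definition b2 (th : B2) : B1 := dualB2 (bform th).

Definition b3 (r : R) : B2 := r *: dualB1 b1.

Lemma q_linear : linear q.
Proof.
move=> c nu nu'; rewrite /q scaler_sumr -big_split; apply: eq_bigr => m1 _ /=.
rewrite scaler_sumr -big_split; apply: eq_bigr => m2 _ /=.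
rewrite add_lfunE scale_lfunE scalerA -scalerDl; congr (_ *: _).
by rewrite mulrDr mulrCA.
Qed.

Lemma pmx_sym : pmx^T = pmx.
Proof.
by apply/matrixP => i j; rewrite [LHS]mxE [LHS]mxE [RHS]mxE; apply: contractC.
Qed.

Lemma fQ_sym nu nu' : fQ nu nu' = fQ nu' nu.
Proof.
have fQE u v : fQ u v = \sum_(m1 : mon 3 n.-1) \sum_(m2 : mon 3 n.-1)
    \adj pmx (enum_rank m1) (enum_rank m2) * u (mono n.-1 m2) * v (mono n.-1 m1).
  rewrite /fQ /q linear_sum; apply: eq_bigr => m1 _.
  by rewrite linear_sum; apply: eq_bigr => m2 _; rewrite linearZ.
rewrite !fQE exchange_big; apply: eq_bigr => m1 _; apply: eq_bigr => m2 _ /=.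
have -> : \adj pmx (enum_rank m2) (enum_rank m1)
    = \adj pmx (enum_rank m1) (enum_rank m2).
  by rewrite -[in LHS]pmx_sym -trmx_adj mxE.
by rewrite -mulrA [X in _ * X]mulrC mulrA.
Qed.

Lemma fQ_linearl nu : linear (fun u => fQ u nu : R^o).
Proof. by move=> c nu1 nu2; rewrite /fQ q_linear linearP. Qed.

Lemma fQ_linearr nu : linear (fun u => fQ nu u : R^o).
Proof. by move=> c nu1 nu2; rewrite /fQ add_lfunE scale_lfunE. Qed.

Lemma dwiden_linear N : linear (@dwiden N).
Proof.
move=> c nu nu'; rewrite /dwiden scaler_sumr -big_split /=.
by apply: eq_bigr => m _; rewrite add_lfunE scale_lfunE scalerDl scalerA.
Qed.

Lemma zD_linear : linear zD.
Proof. by move=> c nu nu'; rewrite /zD dwiden_linear contract_linear. Qed.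

Lemma yD_linear : linear yD.
Proof. by move=> c nu nu'; rewrite /yD dwiden_linear contract_linear. Qed.

Lemma mwiden_linear N c (mu mu' : S0 N) :
  mwiden (c *: mu + mu' : S0 N) = c *: mwiden mu + mwiden mu'.
Proof. by rewrite linearP mwidenD mwidenZ. Qed.

Lemma zPhit_linear : linear zPhit.
Proof.
move=> c mu mu'; rewrite /zPhit mwiden_linear mulrDr -scalerAr.
exact: contract_linearl.
Qed.

Lemma yPhit_linear : linear yPhit.
Proof.
move=> c mu mu'; rewrite /yPhit mwiden_linear mulrDr -scalerAr.
exact: contract_linearl.
Qed.

Lemma evar_linearl i nu : linear (fun mu => evar i mu nu : R^o).
Proof.
by move=> c mu mu'; rewrite /evar linearP mulrDr -scalerAr !linearP.
Qed.

Lemma evar_linearr i mu : linear (fun nu => evar i mu nu : R^o).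
Proof. by move=> c nu nu'; rewrite /evar add_lfunE scale_lfunE. Qed.

Lemma bform_skew th th' : bform th th' = - bform th' th.
Proof.
case: th th' => mu nu [mu' nu']; rewrite /bform /beta1 /beta2 /beta3.
move: (Psi 'X_ix) (Psi 'X_iy) (Psi 'X_iz) (delta n) (evar jz mu nu')
  (evar jz mu' nu) (evar jy mu nu') (evar jy mu' nu) => x y z dl e1 e2 e3 e4.
move: (zPhit mu) (yPhit mu) (zD nu) (yD nu) (zPhit mu') (yPhit mu') (zD nu')
  (yD nu') => a b c d a' b' c' d'.
rewrite (fQ_sym a' b) (fQ_sym b' a) (fQ_sym c' d) (fQ_sym d' c).
move: (fQ a b') (fQ b a') (fQ a d') (fQ b c') (fQ a' d) (fQ b' c) (fQ c d')
  (fQ d c') => f1 f2 f3 f4 f5 f6 f7 f8.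
by ring.
Qed.

Lemma bform_alt th : bform th th = 0.
Proof.
case: th => mu nu; rewrite /bform /beta1 /beta3.
move: (Psi 'X_ix) (Psi 'X_iy) (Psi 'X_iz) (delta n) (evar jz mu nu)
  (evar jy mu nu) (beta2 mu nu) => x y z dl e1 e2 b2.
move: (zPhit mu) (yPhit mu) (zD nu) (yD nu) => a b c d.
rewrite (fQ_sym b a) (fQ_sym d c).
move: (fQ a b) (fQ c d) => f1 f2.
by ring.
Qed.

Lemma bform_linearr th : linear (fun th' => bform th th' : R^o).
Proof.
case: th => mu nu k [mu1 nu1] [mu2 nu2]; rewrite /bform /=.
rewrite /beta1 /beta2 /beta3.
rewrite zPhit_linear yPhit_linear zD_linear yD_linear !evar_linearr !evar_linearl.
move: (Psi 'X_ix) (Psi 'X_iy) (Psi 'X_iz) (delta n) => x y z dl.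
move: (evar jz mu nu1) (evar jz mu nu2) (evar jz mu1 nu) (evar jz mu2 nu)
  (evar jy mu nu1) (evar jy mu nu2) (evar jy mu1 nu) (evar jy mu2 nu)
  => e1 e2 e3 e4 e5 e6 e7 e8.
move: (zPhit mu) (yPhit mu) (zD nu) (yD nu) (zPhit mu1) (yPhit mu1) (zD nu1)
  (yD nu1) (zPhit mu2) (yPhit mu2) (zD nu2) (yD nu2)
  => a b c d a1 b1 c1 d1 a2 b2 c2 d2.
rewrite !fQ_linearr !fQ_linearl /GRing.scale /=.
move: (fQ a b1) (fQ a b2) (fQ b a1) (fQ b a2) (fQ a d1) (fQ a d2) (fQ b c1)
  (fQ b c2) (fQ a1 d) (fQ a2 d) (fQ b1 c) (fQ b2 c) (fQ c d1) (fQ c d2)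
  (fQ d c1) (fQ d c2) => f1 f2 f3 f4 f5 f6 f7 f8 f9 f10 f11 f12 f13 f14 f15 f16.
by ring.
Qed.

Lemma bform_linearl th : linear (fun th' => bform th' th : R^o).
Proof.
move=> c th1 th2; rewrite bform_skew bform_linearr (bform_skew th1) (bform_skew th2).
by rewrite opprD scalerN.
Qed.

Section LinearFormOnPairs.
Context {V W : lmodType R} (f : V * W -> R) (f_lin : linear (f : V * W -> R^o)).

Lemma linear_pairE v w : f (v, w) = f (v, 0) + f (0, w).
Proof.
have -> : (v, w) = 1 *: (v, 0) + (0, w) :> V * W.
  by rewrite scale1r; congr (_, _); rewrite /= ?addr0 ?add0r.
by rewrite f_lin scale1r.
Qed.

Lemma linear_inl : linear (fun v => f (v, 0) : R^o).
Proof.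
move=> c v v'; rewrite -f_lin; congr f.
by congr (_, _); rewrite /= scaler0 addr0.
Qed.

Lemma linear_inr : linear (fun w => f (0, w) : R^o).
Proof.
move=> c w w'; rewrite -f_lin; congr f.
by congr (_, _); rewrite /= scaler0 addr0.
Qed.

End LinearFormOnPairs.

Lemma linear_sumE (V : lmodType R) (f : V -> R) I (r : seq I) (P : pred I)
    (c : I -> R) (v : I -> V) :
  linear (f : V -> R^o) ->
  f (\sum_(i <- r | P i) c i *: v i) = \sum_(i <- r | P i) c i * f (v i).
Proof.
move=> f_lin.
have f0 : f 0 = 0.
  by have := f_lin (-1) 0 0; rewrite scaler0 addr0 scaleN1r addNr.
elim/big_rec2: _ => // i y1 y2 _ <-; exact: f_lin.
Qed.

Lemma dualB2P (f : B2 -> R) :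
  linear (f : B2 -> R^o) -> forall th, pairing (dualB2 f) th = f th.
Proof.
move=> f_lin [mu nu]; rewrite /pairing /dualB2 (linear_pairE f_lin).
congr (_ + _); first exact: (linfunE (linear_inl f_lin)).
rewrite [in RHS](dhomog_dmono nu) (linear_sumE _ _ _ _ (linear_inr f_lin)).
rewrite linear_sum; apply: eq_bigr => m _.
by rewrite linearZ; apply: mulrC.
Qed.

Lemma dualB1P (g : B1 -> R) :
  linear (g : B1 -> R^o) -> forall eta, pairing eta (dualB1 g) = g eta.
Proof.
move=> g_lin [nu mu]; rewrite /pairing /dualB1 (linear_pairE g_lin).
congr (_ + _); last exact: (linfunE (linear_inr g_lin)).
rewrite [in RHS](dhomog_dmono nu) (linear_sumE _ _ _ _ (linear_inl g_lin)).
rewrite linear_sum; apply: eq_bigr => m _.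
by rewrite linearZ; apply: mulrC.
Qed.

Lemma Psi_linear c (u v : {mpoly R[3]}) : Psi (c *: u + v) = c * Psi u + Psi v.
Proof. by rewrite /Psi mevalD mevalZ. Qed.

Lemma b1_linear : linear (b1 : B1 -> R^o).
Proof.
move=> c [nu1 mu1] [nu2 mu2]; rewrite /b1 /=.
rewrite dwiden_linear mwiden_linear contract_linearl !q_linear.
have lS := @mpoly_of_dhomog_is_linear 3 R n.-1.
rewrite !lS !Psi_linear /GRing.scale /=.
generalize (Psi 'X_ix) (delta n) (Psi (q (dwiden nu1))) (Psi (q (dwiden nu2)))
  (Psi (mwiden mu1)) (Psi (mwiden mu2))
  (Psi (q (contract n.-1 (mwiden mu1) Phit)))
  (Psi (q (contract n.-1 (mwiden mu2) Phit))) => x1 x2 x3 x4 x5 x6 x7 x8.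
by ring.
Qed.

Lemma b2P th th' : pairing (b2 th) th' = bform th th'.
Proof. exact: (dualB2P (bform_linearr th)). Qed.

Lemma b2_linear : linear b2.
Proof.
move=> c th1 th2; rewrite /b2 /dualB2; congr (_, _) => /=.
  apply/lfunP => mu; rewrite add_lfunE scale_lfunE.
  rewrite (linfunE (linear_inl (bform_linearr (c *: th1 + th2)))).
  rewrite (linfunE (linear_inl (bform_linearr th1))).
  rewrite (linfunE (linear_inl (bform_linearr th2))).
  exact: bform_linearl.
rewrite scaler_sumr -big_split; apply: eq_bigr => m _.
rewrite [LHS](_ : _ = (c * bform th1 (0, dmono n m) + bform th2 (0, dmono n m))
                      *: mono n m).
  by rewrite scalerDl scalerA.
by congr (_ *: _); exact: (bform_linearl (0, dmono n m) c th1 th2).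
Qed.

Lemma b3P eta : pairing eta (b3 1) = b1 eta.
Proof. by rewrite /b3 scale1r; apply: (dualB1P b1_linear). Qed.

End Maps.

Arguments B1 n : clear implicits.
Arguments B2 n : clear implicits.

(* Below [m] is a monomial in y and z: the elements 1 (x) m^* and 1 (x) m of B_1,
   then 1 (x) m and 1 (x) m^* of B_2. *)
Definition B1D n (m : 'X_{1..2}) : B1 n := (dmono n.-1 m, 0).
Definition B1S n (m : 'X_{1..2}) : B1 n := (0, mono n m).
Definition B2S n (m : 'X_{1..2}) : B2 n := (mono n.-1 m, 0).
Definition B2D n (m : 'X_{1..2}) : B2 n := (0, dmono n m).

Definition chi n (b : bool) : Rn n := b%:R.

Definition mx22 n (a b c d : Rn n) : 'M[Rn n]_2 :=
  \matrix_(i < 2, j < 2)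
    if i == 0 then (if j == 0 then a else b) else (if j == 0 then c else d).

(* Main.v *)
Require Import Defs.
From mathcomp Require Import all_boot all_order all_algebra zify ring.
From mathcomp.multinomials Require Import mpoly.

(** All maps of the complex are assembled linearly from [q], from contraction
   with [Phit], and from contraction with a variable, so the formulas follow by
   evaluating these three on bases.

   The matrix of [p] is T because contracting [Phi] with a product m m' of two
   monomials of degree n - 1 gives t_(m m') ([pmxE]); hence the bilinear form
   [fQ] takes the value Q_(a, b) on a pair of dual monomials ([fQ_dmono]).
   When w is a monomial of degree n in y and z, a monomial k of degree n - 1
   satisfies (w (Phi~))(k) = Phi~(w k), which vanishes unless x divides k, say
   k = x m1, and is then t_(m1 w). So w (Phi~) is the sum of the
   t_(m1 w) (x m1)^* over the m1 of degree n - 2 ([contract_Phit]): every index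
   x M of Q in the formulas, with its factor t, comes from here. Contracting m^*
   with a variable v gives (m / v)^* if v divides m and 0 otherwise
   ([contract_dmono_var]): every factor chi comes from there.

   A form on [B2] or on [B1] is the combination of the dual basis elements with
   its values on the basis as coefficients ([dualB2E], [dualB1E]). For [b1] this
   is the formula for [b3 1]; for [bform th] it reduces the formulas for [b2] to
   the values of [beta1], [beta2] and [beta3] on basis elements ([beta1_mono],
   [beta2_mono], [beta3_mono]). In these sums, those running over the multiples of a variable
   are turned into sums over the quotients by [sum_mon_dvd]. *)

Set Implicit Arguments.
Unset Strict Implicit.
Unset Printing Implicit Defensive.

Import GRing.Theory.
Local Open Scope ring_scope.

(** * Sums over the monomials of a given degree *)

Lemma sum_mon1 (V : nmodType) k N (a : 'X_{1..k}) (dega : mdeg a == N)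
    (F : mon k N -> V) :
  (forall m : mon k N, mon_val m != a -> F m = 0) -> \sum_m F m = F (Mon dega).
Proof.
move=> F0; rewrite (bigD1 (Mon dega)) //= big1 => [|m ne_ma]; first exact: addr0.
by apply: F0; apply: contra ne_ma => /eqP eq_ma; apply/eqP; exact: val_inj.
Qed.

(** Multiplication by the variable i is a bijection from the monomials of degree
   N - 1 onto the monomials of degree N that i divides. *)
Lemma sum_mon_dvd (V : nmodType) k N (i : 'I_k) (F : 'X_{1..k} -> V) :
  (0 < N)%N ->
  \sum_(m : mon k N | (U_(i) <= m)%MM) F m
  = \sum_(m : mon k N.-1) F (U_(i) + m)%MM.
Proof.
move=> N_gt0.
have mulP (m : mon k N.-1) : mdeg (U_(i) + m)%MM == N.
  by rewrite mdegD mdeg1 mon_deg add1n prednK.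
have divP (m : mon k N) : (U_(i) <= m)%MM -> mdeg (m - U_(i))%MM == N.-1.
  move=> le_im; rewrite -(eqn_add2r 1) -[X in (_ + X)%N == _](mdeg1 i) -mdegD submK //.
  by rewrite mon_deg addn1 prednK.
transitivity (\sum_(m : mon k N | (U_(i) <= m)%MM)
                \sum_(m' : mon k N.-1 | m == Mon (mulP m')) F m).
  apply: eq_bigr => m le_im; rewrite (big_pred1 (Mon (divP m le_im))) // => m' /=.
  rewrite -[m' == _]val_eqE -[m == _]val_eqE.
  change ((m == U_(i) + m' :> 'X_{1..k})%MM = (m' == m - U_(i) :> 'X_{1..k})%MM).
  by rewrite -[in LHS](submK le_im) addmC eqm_add2l eq_sym.
rewrite (exchange_big_dep xpredT) //=; apply: eq_bigr => m' _.
rewrite (big_pred1 (Mon (mulP m'))) // => m /=.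
by rewrite andb_idl // => /eqP->; exact: lem_addr.
Qed.

Lemma sum_mon_delta (A : nzRingType) (V : lmodType A) k N (a : 'X_{1..k})
    (F : 'X_{1..k} -> V) :
  mdeg a = N -> \sum_(m : mon k N) (a == m :> 'X_{1..k})%:R *: F m = F a.
Proof.
move/eqP=> dega; rewrite (sum_mon1 dega) => [|m ne_ma]; first by rewrite eqxx scale1r.
by rewrite eq_sym (negPf ne_ma) scale0r.
Qed.

(** * Linear functions on bases *)

Lemma linear_fun0 (A : nzRingType) (V W : lmodType A) (f : V -> W) :
  linear f -> f 0 = 0.
Proof.
by move=> f_lin; have := f_lin (-1) 0 0; rewrite scaler0 addr0 scaleN1r addNr.
Qed.

Lemma pair_sumZ (A : nzRingType) (V W : lmodType A) (I J : finType) (a : I -> A)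
    (b : J -> A)    (v : I -> V) (w : J -> W) :
  (\sum_i a i *: v i, \sum_j b j *: w j)
  = \sum_i a i *: (v i, 0 : W) + \sum_j b j *: (0 : V, w j).
Proof.
have inl : \sum_i a i *: (v i, 0 : W) = (\sum_i a i *: v i, 0).
  by elim/big_rec2: _ => // i y1 y2 _ ->; congr (_, _); rewrite /= scaler0 addr0.
have inr : \sum_j b j *: (0 : V, w j) = (0, \sum_j b j *: w j).
  by elim/big_rec2: _ => // i y1 y2 _ ->; congr (_, _); rewrite /= scaler0 addr0.
by rewrite inl inr; congr (_, _); rewrite /= ?addr0 ?add0r.
Qed.

Lemma dmono_mono (A : comNzRingType) k N (a b : 'X_{1..k.+1}) :
  mdeg b = N -> dmono N a (mono N b : dhomog k.+1 A N) = (b == a)%:R.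
Proof. by move=> degb; rewrite dmonoE val_mono // mcoeffX. Qed.

Lemma lfun_mono_ext (A : comNzRingType) k N
    (nu nu' : 'Hom(dhomog k.+1 A N, A^o)) :
  (forall m : mon k.+1 N, nu (mono N m) = nu' (mono N m)) -> nu = nu'.
Proof.
move=> eq_nu; rewrite (dhomog_dmono nu) (dhomog_dmono nu').
by apply: eq_bigr => m _; rewrite eq_nu.
Qed.

Lemma hpart_mulX (A : comNzRingType) k N K (a b : 'X_{1..k.+1}) :
  mdeg b = K -> hpart N ('X_[a] * (mono K b : dhomog k.+1 A K)) = mono N (a + b).
Proof. by move=> degb; rewrite val_mono // -mpolyXD. Qed.

Lemma mdeg_mnmwiden k (m : 'X_{1..k}) : mdeg (mnmwiden m) = mdeg m.
Proof.
rewrite !mdegE big_ord_recr /= mnmwiden_ordmax addn0.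
by apply: eq_bigr => i _; rewrite mnmwiden_widen.
Qed.

Section Basis.
Variable n : nat.
Local Notation R := (Rn n).

Lemma sum_mon_chi (V : lmodType R) k N (i : 'I_k) (c : 'X_{1..k} -> R)
    (F : 'X_{1..k} -> V) : (0 < N)%N ->
  \sum_(m : mon k N) (chi n (U_(i) <= m)%MM * c (m - U_(i))%MM) *: F m
  = \sum_(m : mon k N.-1) c m *: F (U_(i) + m)%MM.
Proof.
move=> N_gt0; transitivity (\sum_(m : mon k N | (U_(i) <= m)%MM) c (m - U_(i))%MM *: F m).
  rewrite [RHS]big_mkcond; apply: eq_bigr => m _; rewrite /chi.
  by case: ifP => _; rewrite ?mul1r // mul0r scale0r.
rewrite (sum_mon_dvd i (fun m => c (m - U_(i))%MM *: F m) N_gt0).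
by apply: eq_bigr => m _; rewrite addmC addmK.
Qed.

Lemma sum_mon_var_delta (V : lmodType R) k N (i : 'I_k) (m : mon k N)
    (F : 'X_{1..k} -> V) : (0 < N)%N ->
  \sum_(M : mon k N.-1) (U_(i) + M == m :> 'X_{1..k})%MM%:R *: F M
  = chi n (U_(i) <= m)%MM *: F (m - U_(i))%MM.
Proof.
move=> N_gt0; pose G m' := chi n (U_(i) <= m')%MM *: F (m' - U_(i))%MM.
rewrite -/(G m) -(sum_mon_delta G (mon_deg m)).
transitivity (\sum_(m' : mon k N | (U_(i) <= m')%MM) (m == m' :> 'X_{1..k})%:R *: G m').
  rewrite (sum_mon_dvd i (fun m' => (m == m' :> 'X_{1..k})%:R *: G m') N_gt0).
  apply: eq_bigr => M _; rewrite /G /chi lem_addr scale1r addmC addmK.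
  by rewrite addmC eq_sym.
rewrite big_mkcond; apply: eq_bigr => m' _; case: ifP => // nle_im.
by rewrite /G nle_im /chi scale0r scaler0.
Qed.

(** * The maps p and q in the monomial bases *)

Lemma t_Phi (m : 'X_{1..3}) :
  mdeg m = (2 * n - 2)%N -> @Phi n (mono (2 * n - 2) m) = t n m.
Proof.
move=> degm; have degmP : mdeg m == (2 * n - 2)%N by apply/eqP.
rewrite /Phi sum_lfunE (sum_mon1 degmP) => [|m' ne_m'm].
  by rewrite scale_lfunE dmono_mono // eqxx; apply: mulr1.
by rewrite scale_lfunE dmono_mono // eq_sym (negPf ne_m'm); apply: mulr0.
Qed.

Lemma pmxE : (0 < n)%N -> @pmx n = Tmx n.
Proof.
move=> n_gt0; apply/matrixP => i j; rewrite !mxE /p contractE val_mono ?mon_deg //.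
rewrite hpart_mulX ?mon_deg // t_Phi; first by rewrite addmC.
by rewrite mdegD !mon_deg; lia.
Qed.

Lemma q_dmono (m : 'X_{1..3}) : (0 < n)%N ->
  q (dmono n.-1 m) = \sum_(m1 : mon 3 n.-1) Q n m1 m *: mono n.-1 m1.
Proof.
move=> n_gt0; rewrite /q; apply: eq_bigr => m1 _.
rewrite -scaler_suml; congr (_ *: _); rewrite /Q valK.
case: insubP => [m2 _ def_m2|degm].
  have degm : mdeg m == n.-1 by rewrite -def_m2 mon_deg.
  rewrite (sum_mon1 degm) => [|m3 ne_m3]; last first.
    by rewrite dmono_mono ?mon_deg // (negPf ne_m3) mulr0.
  rewrite dmono_mono ?mon_deg // eqxx mulr1 pmxE //; congr (\adj _ _ (enum_rank _)).
  exact: val_inj.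
(* In a degree other than n - 1 both m^* and Q_(m1, m) are 0. *)
rewrite big1 // => m2 _; rewrite dmono_mono ?mon_deg //.
case: eqP => [eq_m2|_]; last by rewrite mulr0.
by move: degm; rewrite -eq_m2 mon_deg eqxx.
Qed.

Lemma fQ_dmono (a b : 'X_{1..3}) : (0 < n)%N ->
  fQ (dmono n.-1 a) (dmono n.-1 b) = Q n b a.
Proof.
move=> n_gt0; rewrite /fQ q_dmono // linear_sum /=.
have termE (m : mon 3 n.-1) : dmono n.-1 b (Q n m a *: mono n.-1 m : dhomog 3 R n.-1)
    = Q n m a * (mon_val m == b)%:R.
  by rewrite linearZ /= dmono_mono ?mon_deg.
rewrite (eq_bigr _ (fun m _ => termE m)).
have [degb|degb] := boolP (mdeg b == n.-1).
  rewrite (sum_mon1 degb) => [|m ne_mb]; first by rewrite eqxx mulr1.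
  by rewrite (negPf ne_mb) mulr0.
rewrite big1 => [|m _]; first by rewrite /Q; case: insubP => [b' |//]; rewrite (negPf degb).
case: eqP => [eq_m|_]; last exact: mulr0.
by move: degb; rewrite -eq_m mon_deg eqxx.
Qed.

Lemma Q_sym (a b : 'X_{1..3}) : (0 < n)%N -> Q n a b = Q n b a.
Proof. by move=> n_gt0; rewrite -(fQ_dmono b a n_gt0) -(fQ_dmono a b n_gt0) fQ_sym. Qed.

Lemma Psi_q_dmono (m : 'X_{1..3}) : (0 < n)%N ->
  Psi (q (dmono n.-1 m) : dhomog 3 R n.-1) = lambda m.
Proof.
move=> n_gt0; rewrite q_dmono // linear_sum /Psi raddf_sum.
apply: eq_bigr => m1 _; rewrite linearZ /= mevalZ val_mono ?mon_deg //.
exact: mulrC.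
Qed.

Lemma fQ_ZZ (a c : R) u v : fQ (a *: u) (c *: v) = a * c * fQ u v :> R.
Proof.
have linZ (V : lmodType R) (f : V -> R) b w : linear (f : V -> R^o) -> f (b *: w) = b * f w.
  move=> f_lin; have := linear_sumE [:: tt] xpredT (fun=> b) (fun=> w) f_lin.
  by rewrite !big_seq1.
rewrite (linZ _ (fun v => fQ (a *: u) v) c v (fQ_linearr _)).
by rewrite (linZ _ (fun u => fQ u v) a u (fQ_linearl _)) mulrCA mulrA.
Qed.

Lemma fQ_sumr (J : finType) u v :
  fQ u (\sum_(j : J) v j) = \sum_(j : J) fQ u (v j) :> R.
Proof. by rewrite /fQ sum_lfunE. Qed.

Lemma fQ_suml (I : finType) u v :
  fQ (\sum_(i : I) u i) v = \sum_(i : I) fQ (u i) v :> R.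
Proof. by rewrite fQ_sym fQ_sumr; apply: eq_bigr => i _; exact: fQ_sym. Qed.

(** * Contractions of divided powers by monomials *)

Lemma Phit_xM (m : 'X_{1..3}) : (0 < n)%N -> mdeg m = (2 * n - 2)%N ->
  @Phit n (mono (2 * n - 1) (U_(ix) + m)) = t n m.
Proof.
move=> n_gt0 degm; have degmP : mdeg m == (2 * n - 2)%N by apply/eqP.
have degxm : mdeg (U_(ix) + m)%MM = (2 * n - 1)%N by rewrite mdegD mdeg1 degm; lia.
rewrite /Phit sum_lfunE (sum_mon1 degmP) => [|m' ne_m'm].
  by rewrite scale_lfunE dmono_mono // eqxx; apply: mulr1.
by rewrite scale_lfunE dmono_mono // eqm_add2l eq_sym (negPf ne_m'm); apply: mulr0.
Qed.

Lemma Phit_yz (m : 'X_{1..3}) : ~~ (U_(ix) <= m)%MM -> mdeg m = (2 * n - 1)%N ->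
  @Phit n (mono (2 * n - 1) m) = 0.
Proof.
move=> xm degm; rewrite /Phit sum_lfunE big1 // => m' _.
rewrite scale_lfunE dmono_mono //; case: eqP => [eq_mm'|_]; last exact: mulr0.
by move: xm; rewrite eq_mm' lem_addr.
Qed.

(** As w is prime to x, a monomial w k is divisible by x only when k is; so only
   the (x m1)^* occur, each with the coefficient Phi~(w x m1) = t_(m1 w). *)
Lemma contract_Phit (w : 'X_{1..3}) : (2 <= n)%N -> mdeg w = n -> w ix = 0%N ->
  contract n.-1 'X_[w] (@Phit n)
  = \sum_(m1 : mon 3 n.-2) t n (m1 + w)%MM *: dmono n.-1 (U_(ix) + m1).
Proof.
move=> n_ge2 degw w_x; rewrite [LHS]dhomog_dmono.
rewrite (bigID (fun k : mon 3 n.-1 => (U_(ix) <= k)%MM)) /= [X in _ + X]big1 ?addr0.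
  rewrite (sum_mon_dvd ix (fun k => contract n.-1 'X_[w] Phit (mono n.-1 k)
                                    *: dmono n.-1 k)); last by lia.
  apply: eq_bigr => m1 _; congr (_ *: _).
  rewrite contractE hpart_mulX; last by rewrite mdegD mdeg1 mon_deg; lia.
  have -> : (w + (U_(ix) + m1))%MM = (U_(ix) + (m1 + w))%MM.
    by apply/mnmP => i; rewrite !mnmDE; lia.
  by rewrite Phit_xM //; [lia | rewrite mdegD mon_deg degw; lia].
move=> k xk; rewrite contractE hpart_mulX ?mon_deg // Phit_yz ?scale0r //.
  by move: xk; rewrite !lep1mP mnmDE w_x.
by rewrite mdegD mon_deg degw; lia.
Qed.

Lemma contract_widen_Phit (w : 'X_{1..2}) : (2 <= n)%N -> mdeg w = n ->
  contract n.-1 'X_[mnmwiden w] (@Phit n)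
  = \sum_(m1 : mon 3 n.-2) t n (m1 + mnmwiden w)%MM *: dmono n.-1 (U_(ix) + m1).
Proof.
move=> n_ge2 degw; rewrite contract_Phit ?mdeg_mnmwiden //.
have -> : ix = ord_max by apply: val_inj.
exact: mnmwiden_ordmax.
Qed.

Lemma contract_dmono_var N (i : 'I_3) (m : 'X_{1..3}) : (0 < N)%N -> mdeg m = N ->
  contract N.-1 'X_i (dmono N m : 'Hom(dhomog 3 R N, R^o))
  = chi n (U_(i) <= m)%MM *: dmono N.-1 (m - U_(i)).
Proof.
move=> N_gt0 degm; apply: lfun_mono_ext => k.
rewrite contractE hpart_mulX ?mon_deg // scale_lfunE.
rewrite !dmono_mono ?mon_deg //; last by rewrite mdegD mdeg1 mon_deg add1n prednK.
rewrite /chi; case: (boolP (U_(i) <= m)%MM) => [le_im|nle_im].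
  rewrite -[X in _ == X](submK le_im) addmC eqm_add2r; exact/esym/mul1r.
rewrite [RHS]mul0r; case: eqP => // eq_m.
by move: nle_im; rewrite -eq_m lem_addr.
Qed.

Lemma dwiden_dmono N (m : 'X_{1..2}) : mdeg m = N ->
  dwiden (dmono N m : 'Hom(dhomog 2 R N, R^o)) = dmono N (mnmwiden m).
Proof.
move=> degm; have degmP : mdeg m == N by apply/eqP.
rewrite /dwiden (sum_mon1 degmP) => [|m' ne_m'm].
  by rewrite dmono_mono // eqxx scale1r.
by rewrite dmono_mono ?mon_deg // (negPf ne_m'm) scale0r.
Qed.

(** The inclusion of the variables of U_0 among those of U, as an index that the
   lemmas on y and z can share. *)
Definition wvar (j : 'I_2) : 'I_3 := widen_ord (leqnSn 2) j.

Lemma wvar_y : wvar jy = iy. Proof. exact: val_inj. Qed.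
Lemma wvar_z : wvar jz = iz. Proof. exact: val_inj. Qed.

Lemma contract_var_Phit (j : 'I_2) (m : mon 2 n.-1) : (2 <= n)%N ->
  contract n.-1 ('X_(wvar j) * mwiden (mono n.-1 m : dhomog 2 R n.-1)) (@Phit n)
  = \sum_(M : mon 3 n.-2)
      t n (M + mnmwiden m + U_(wvar j))%MM *: dmono n.-1 (U_(ix) + M).
Proof.
move=> n_ge2; rewrite val_mono ?mon_deg // mwidenX -mpolyXD.
have -> : (U_(wvar j) + mnmwiden m = mnmwiden (U_(j) + m))%MM.
  by rewrite mnmwidenD mnmwiden1.
have degw : mdeg (U_(j) + m)%MM = n by rewrite mdegD mdeg1 mon_deg; lia.
rewrite (contract_widen_Phit n_ge2 degw).
apply: eq_bigr => M _; congr (t n _ *: _).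
by rewrite mnmwidenD mnmwiden1 -addmA [(mnmwiden m + _)%MM]addmC.
Qed.

Lemma contract_var_dwiden (j : 'I_2) (m : mon 2 n) : (0 < n)%N ->
  contract n.-1 'X_(wvar j) (dwiden (dmono n m : 'Hom(dhomog 2 R n, R^o)))
  = chi n (U_(j) <= m)%MM *: dmono n.-1 (mnmwiden (m - U_(j))).
Proof.
move=> n_gt0; have degw : mdeg (mnmwiden m) = n by rewrite mdeg_mnmwiden mon_deg.
rewrite (dwiden_dmono (mon_deg m)) (contract_dmono_var (wvar j) n_gt0 degw).
have -> : (U_(wvar j) <= mnmwiden m)%MM = (U_(j) <= m)%MM.
  by rewrite !lep1mP mnmwiden_widen.
have [le_jm|_] := boolP (U_(j) <= m)%MM; last by rewrite /chi !scale0r.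
by rewrite -[in LHS](submK le_jm) mnmwidenD mnmwiden1 addmK.
Qed.

Lemma evar_mono (j : 'I_2) (m : mon 2 n.-1) (m' : mon 2 n) : (0 < n)%N ->
  evar j (mono n.-1 m) (dmono n m') = (U_(j) + m == m' :> 'X_{1..2})%MM%:R :> R.
Proof.
move=> n_gt0; rewrite /evar hpart_mulX ?mon_deg // dmono_mono //.
by rewrite mdegD mdeg1 mon_deg; lia.
Qed.

(** * The alternating form on the basis of B_2 *)

Lemma fQ_Phit_Phit (i j : 'I_2) (m2 m1 : mon 2 n.-1) : (2 <= n)%N ->
  fQ (contract n.-1 ('X_(wvar i) * mwiden (mono n.-1 m2 : dhomog 2 R n.-1)) (@Phit n))
     (contract n.-1 ('X_(wvar j) * mwiden (mono n.-1 m1 : dhomog 2 R n.-1)) (@Phit n))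
  = \sum_(M1 : mon 3 n.-2) \sum_(M2 : mon 3 n.-2)
      Q n (U_(ix) + M1)%MM (U_(ix) + M2)%MM
      * (t n (mnmwiden m2 + M2 + U_(wvar i))%MM
         * t n (mnmwiden m1 + M1 + U_(wvar j))%MM).
Proof.
move=> n_ge2; have n_gt0 := ltnW n_ge2.
apply: etrans (congr2 (@fQ n) (contract_var_Phit i m2 n_ge2) (contract_var_Phit j m1 n_ge2)) _.
rewrite fQ_sumr; apply: eq_bigr => M1 _.
rewrite fQ_suml; apply: eq_bigr => M2 _.
rewrite fQ_ZZ fQ_dmono // mulrC.
by rewrite [(M2 + _)%MM]addmC [(M1 + _)%MM]addmC.
Qed.

Lemma fQ_Phit_dwiden (i j : 'I_2) (m2 : mon 2 n.-1) (m1 : mon 2 n) : (2 <= n)%N ->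
  fQ (contract n.-1 ('X_(wvar i) * mwiden (mono n.-1 m2 : dhomog 2 R n.-1)) (@Phit n))
     (contract n.-1 'X_(wvar j) (dwiden (dmono n m1 : 'Hom(dhomog 2 R n, R^o))))
  = \sum_(M : mon 3 n.-2)
      chi n (U_(j) <= m1)%MM
      * Q n (mnmwiden (m1 - U_(j))%MM) (U_(ix) + M)%MM
      * t n (M + mnmwiden m2 + U_(wvar i))%MM.
Proof.
move=> n_ge2; have n_gt0 := ltnW n_ge2.
apply: etrans (congr2 (@fQ n) (contract_var_Phit i m2 n_ge2) (contract_var_dwiden j m1 n_gt0)) _.
rewrite fQ_suml; apply: eq_bigr => M _.
rewrite fQ_ZZ fQ_dmono // -mulrA; exact: mulrC.
Qed.

Lemma fQ_dwiden_dwiden (i j : 'I_2) (m2 m1 : mon 2 n) : (0 < n)%N ->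
  fQ (contract n.-1 'X_(wvar i) (dwiden (dmono n m2 : 'Hom(dhomog 2 R n, R^o))))
     (contract n.-1 'X_(wvar j) (dwiden (dmono n m1 : 'Hom(dhomog 2 R n, R^o))))
  = chi n (U_(i) <= m2)%MM * (chi n (U_(j) <= m1)%MM
      * Q n (mnmwiden (m1 - U_(j))%MM) (mnmwiden (m2 - U_(i))%MM)).
Proof.
move=> n_gt0.
apply: etrans
  (congr2 (@fQ n) (contract_var_dwiden i m2 n_gt0) (contract_var_dwiden j m1 n_gt0)) _.
by rewrite fQ_ZZ fQ_dmono // mulrA.
Qed.

Lemma det_Rmx22 (a b c d : R) : \det (mx22 a b c d) = a * d - b * c.
Proof.
rewrite (expand_det_row _ ord0) !big_ord_recl big_ord0 /cofactor !det_mx11 !mxE /=.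
by rewrite expr0 expr1 mul1r mulN1r mulrN addr0.
Qed.

Lemma beta3_mono (m2 m1 : mon 2 n.-1) : (2 <= n)%N ->
  beta3 (mono n.-1 m2) (mono n.-1 m1)
  = \sum_(M1 : mon 3 n.-2) \sum_(M2 : mon 3 n.-2)
      rx n * Q n (U_(ix) + M1)%MM (U_(ix) + M2)%MM
      * \det (mx22 (t n (mnmwiden m1 + M1 + U_(iy))%MM)
                   (t n (mnmwiden m1 + M1 + U_(iz))%MM)
                   (t n (mnmwiden m2 + M2 + U_(iy))%MM)
                   (t n (mnmwiden m2 + M2 + U_(iz))%MM)).
Proof.
move=> n_ge2.
transitivity (rx n * (fQ (zPhit (mono n.-1 m2)) (yPhit (mono n.-1 m1))
                      - fQ (yPhit (mono n.-1 m2)) (zPhit (mono n.-1 m1)))).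
  by congr (_ * _); exact: mevalXU.
apply: etrans (congr2 (fun a b => rx n * (a - b))
  (fQ_Phit_Phit jz jy m2 m1 n_ge2) (fQ_Phit_Phit jy jz m2 m1 n_ge2)) _ => /=.
rewrite -sumrB mulr_sumr; apply: eq_bigr => M1 _.
rewrite -sumrB mulr_sumr; apply: eq_bigr => M2 _.
by rewrite det_Rmx22 wvar_y wvar_z -mulrBr mulrA
   [X in _ * (X - _)]mulrC [X in _ * (_ - X)]mulrC.
Qed.

Lemma beta2_mono (m2 : mon 2 n.-1) (m1 : mon 2 n) : (2 <= n)%N ->
  beta2 (mono n.-1 m2) (dmono n m1)
  = \sum_(M : mon 3 n.-2)
      rx n * (chi n (U_(jy) <= m1)%MM
              * Q n (mnmwiden (m1 - U_(jy))%MM) (U_(ix) + M)%MM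
              * t n (M + mnmwiden m2 + U_(iz))%MM
              - chi n (U_(jz) <= m1)%MM
                * Q n (mnmwiden (m1 - U_(jz))%MM) (U_(ix) + M)%MM
                * t n (M + mnmwiden m2 + U_(iy))%MM).
Proof.
move=> n_ge2.
transitivity (rx n * (fQ (zPhit (mono n.-1 m2)) (yD (dmono n m1))
                      - fQ (yPhit (mono n.-1 m2)) (zD (dmono n m1)))).
  by congr (_ * _); exact: mevalXU.
apply: etrans (congr2 (fun a b => rx n * (a - b))
  (fQ_Phit_dwiden jz jy m2 m1 n_ge2) (fQ_Phit_dwiden jy jz m2 m1 n_ge2)) _ => /=.
by rewrite -sumrB mulr_sumr wvar_y wvar_z.
Qed.

Lemma beta1_mono (m2 m1 : mon 2 n) : (0 < n)%N ->
  beta1 (dmono n m2) (dmono n m1)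
  = chi n (U_(jz) <= m2)%MM * (chi n (U_(jy) <= m1)%MM
      * (rx n * Q n (mnmwiden (m1 - U_(jy))%MM) (mnmwiden (m2 - U_(jz))%MM)))
    - chi n (U_(jy) <= m2)%MM * (chi n (U_(jz) <= m1)%MM
      * (rx n * Q n (mnmwiden (m1 - U_(jz))%MM) (mnmwiden (m2 - U_(jy))%MM))).
Proof.
move=> n_gt0.
transitivity (rx n * (fQ (zD (dmono n m2)) (yD (dmono n m1))
                      - fQ (yD (dmono n m2)) (zD (dmono n m1)))).
  by congr (_ * _); exact: mevalXU.
apply: etrans (congr2 (fun a b => rx n * (a - b))
  (fQ_dwiden_dwiden jz jy m2 m1 n_gt0) (fQ_dwiden_dwiden jy jz m2 m1 n_gt0)) _ => /=.
rewrite mulrBr; congr (_ - _); rewrite mulrCA; congr (_ * _); exact: mulrCA.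
Qed.

Lemma fQ0r u : fQ u 0 = 0 :> R. Proof. exact: (linear_fun0 (fQ_linearr u)). Qed.

Lemma fQ0l u : fQ 0 u = 0 :> R. Proof. exact: (linear_fun0 (fQ_linearl u)). Qed.

(** Each of [beta1], [beta2] and [beta3] is such a difference, in which a zero
   argument of the form makes one argument of each [fQ] vanish. *)
Lemma sub_fQ0 (u v u' v' : 'Hom(dhomog 3 R n.-1, R^o)) :
  u = 0 \/ v = 0 -> u' = 0 \/ v' = 0 -> Psi 'X_ix * (fQ u v - fQ u' v') = 0 :> R.
Proof.
have fQ0 (a b : 'Hom(dhomog 3 R n.-1, R^o)) : a = 0 \/ b = 0 -> fQ a b = 0 :> R.
  by case=> ->; [exact: fQ0l | exact: fQ0r].
by move=> /fQ0-> /fQ0->; rewrite subrr mulr0.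
Qed.

Lemma beta1_0l nu : beta1 0 nu = 0 :> R.
Proof.
by apply: sub_fQ0; left;
  [exact: linear_fun0 (@zD_linear n) | exact: linear_fun0 (@yD_linear n)].
Qed.

Lemma beta2_0r mu : beta2 mu 0 = 0 :> R.
Proof.
by apply: sub_fQ0; right;
  [exact: linear_fun0 (@yD_linear n) | exact: linear_fun0 (@zD_linear n)].
Qed.

Lemma beta2_0l nu : beta2 0 nu = 0 :> R.
Proof.
by apply: sub_fQ0; left;
  [exact: linear_fun0 (@zPhit_linear n) | exact: linear_fun0 (@yPhit_linear n)].
Qed.

Lemma beta3_0l mu : beta3 0 mu = 0 :> R.
Proof.
by apply: sub_fQ0; left;
  [exact: linear_fun0 (@zPhit_linear n) | exact: linear_fun0 (@yPhit_linear n)].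
Qed.

Lemma beta3_0r mu : beta3 mu 0 = 0 :> R.
Proof.
by apply: sub_fQ0; right;
  [exact: linear_fun0 (@yPhit_linear n) | exact: linear_fun0 (@zPhit_linear n)].
Qed.

Lemma evar0r i mu : evar i mu 0 = 0 :> R. Proof. exact: (linear_fun0 (evar_linearr i mu)). Qed.

Lemma evar0l i nu : evar i 0 nu = 0 :> R. Proof. exact: (linear_fun0 (evar_linearl i nu)). Qed.

Lemma bform_eq mu nu mu' nu' (c3 c2 c2' c1 e1 e2 e3 e4 : R) :
  beta3 mu mu' = c3 -> beta2 mu nu' = c2 -> beta2 mu' nu = c2' -> beta1 nu nu' = c1 ->
  evar jz mu nu' = e1 -> evar jz mu' nu = e2 -> evar jy mu nu' = e3 -> evar jy mu' nu = e4 ->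
  bform (mu, nu) (mu', nu')
  = c3 + c2 - c2' + c1 + ry n * (delta n * (e1 - e2)) - rz n * (delta n * (e3 - e4)).
Proof.
move=> <- <- <- <- <- <- <- <-.
apply: (congr2 (fun y z : R => _ + y * _ - z * _)); exact: mevalXU.
Qed.

Lemma bform_SS mu mu' : bform (mu, 0) (mu', 0) = beta3 mu mu' :> R.
Proof.
apply: etrans (bform_eq (erefl _) (beta2_0r mu) (beta2_0r mu') (beta1_0l 0)
  (evar0r _ _) (evar0r _ _) (evar0r _ _) (evar0r _ _)) _.
by rewrite !(subrr, mulr0, addr0, subr0).
Qed.

Lemma bform_SD mu nu : bform (mu, 0) (0, nu)
  = beta2 mu nu + ry n * delta n * evar jz mu nu - rz n * delta n * evar jy mu nu :> R.
Proof.
apply: etrans (bform_eq (beta3_0r mu) (erefl _) (beta2_0l 0) (beta1_0l nu)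
  (erefl _) (evar0r _ _) (erefl _) (evar0r _ _)) _.
have alg (a y z d e1 e3 : R) : 0 + a - 0 + 0 + y * (d * (e1 - 0)) - z * (d * (e3 - 0))
    = a + y * d * e1 - z * d * e3.
  by rewrite !(addr0, subr0, add0r) !mulrA.
exact: alg.
Qed.

Lemma bform_DD nu nu' : bform (0, nu) (0, nu') = beta1 nu nu' :> R.
Proof.
apply: etrans (bform_eq (beta3_0l 0) (beta2_0l nu') (beta2_0l nu) (erefl _)
  (evar0l _ _) (evar0l _ _) (evar0l _ _) (evar0l _ _)) _.
by rewrite !(subrr, mulr0, addr0, subr0, add0r).
Qed.

(** * The differentials on basis elements *)

Lemma dualB2E (f : B2 n -> R) : linear (f : B2 n -> R^o) ->
  dualB2 f = \sum_(m : mon 2 n.-1) f (B2S n m) *: B1D n m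
           + \sum_(m : mon 2 n) f (B2D n m) *: B1S n m.
Proof.
move=> f_lin; rewrite -pair_sumZ /dualB2; congr (_, _).
rewrite [LHS]dhomog_dmono; apply: eq_bigr => m _.
by rewrite (linfunE (linear_inl f_lin)).
Qed.

Lemma dualB1E (g : B1 n -> R) : linear (g : B1 n -> R^o) ->
  dualB1 g = \sum_(m : mon 2 n.-1) g (B1D n m) *: B2S n m
           + \sum_(m : mon 2 n) g (B1S n m) *: B2D n m.
Proof.
move=> g_lin; rewrite -pair_sumZ /dualB1; congr (_, _).
rewrite [LHS]dhomog_dmono; apply: eq_bigr => m _.
by rewrite (linfunE (linear_inr g_lin)).
Qed.

Lemma Psi0 : Psi (0 : {mpoly R[3]}) = 0. Proof. exact: mevalC. Qed.

Lemma Psi_q0 : Psi (q (0 : 'Hom(dhomog 3 R n.-1, R^o)) : dhomog 3 R n.-1) = 0.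
Proof. by rewrite (linear_fun0 (@q_linear n)) linear0 Psi0. Qed.

Lemma b1_inl nu : b1 ((nu, 0) : B1 n) = rx n * Psi (q (dwiden nu) : dhomog 3 R n.-1).
Proof.
have mw0 : mwiden (0 : dhomog 2 R n) = 0 by rewrite linear0 mwiden0.
have Phit0 : contract n.-1 (mwiden (0 : dhomog 2 R n)) (@Phit n) = 0.
  by rewrite mw0; exact: linear_fun0 (@contract_linearl R 2 (2 * n - 1) n.-1 (@Phit n)).
have E1 : Psi (mwiden (0 : dhomog 2 R n)) = 0 by rewrite mw0 Psi0.
have E2 : Psi (q (contract n.-1 (mwiden (0 : dhomog 2 R n)) (@Phit n))
               : dhomog 3 R n.-1) = 0 by rewrite Phit0 Psi_q0.
apply: etrans (congr2 (fun a b => Psi 'X_ix * Psi (q (dwiden nu) : dhomog 3 R n.-1)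
  + (delta n * a - Psi 'X_ix * b)) E1 E2) _.
rewrite !mulr0 subr0 addr0; congr (_ * _); exact: mevalXU.
Qed.

Lemma b1_inr mu : b1 ((0, mu) : B1 n)
  = delta n * Psi (mwiden mu)
    - rx n * Psi (q (contract n.-1 (mwiden mu) (@Phit n)) : dhomog 3 R n.-1).
Proof.
have E : Psi (q (dwiden (0 : 'Hom(dhomog 2 R n.-1, R^o))) : dhomog 3 R n.-1) = 0.
  by rewrite (linear_fun0 (@dwiden_linear n n.-1)) Psi_q0.
apply: etrans (congr1 (fun a => Psi 'X_ix * a + (delta n * Psi (mwiden mu)
   - Psi 'X_ix * Psi (q (contract n.-1 (mwiden mu) (@Phit n)) : dhomog 3 R n.-1))) E) _.
rewrite mulr0 add0r; congr (_ - _ * _); exact: mevalXU.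
Qed.

Lemma b1_B1D (m : mon 2 n.-1) : (0 < n)%N ->
  b1 (B1D n m) = rx n * lambda (mnmwiden m).
Proof.
move=> n_gt0; apply: etrans (b1_inl _) _; congr (_ * _).
by rewrite (dwiden_dmono (mon_deg m)) Psi_q_dmono.
Qed.

Lemma b1_B1S (m : mon 2 n) : (2 <= n)%N ->
  b1 (B1S n m)
  = delta n * Psi 'X_[mnmwiden m]
    - rx n * \sum_(m1 : mon 3 n.-2) lambda (U_(ix) + m1)%MM * t n (m1 + mnmwiden m)%MM.
Proof.
move=> n_ge2; apply: etrans (b1_inr _) _.
rewrite (val_mono (mon_deg m)) mwidenX; congr (_ - _ * _).
have Psi_q_lin : linear (fun nu : 'Hom(dhomog 3 R n.-1, R^o) =>
    Psi (q nu : dhomog 3 R n.-1) : R^o).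
  by move=> c u v; rewrite q_linear linearP Psi_linear.
rewrite (contract_widen_Phit n_ge2 (mon_deg m)).
apply: etrans (linear_sumE _ _ _ _ Psi_q_lin) _; apply: eq_bigr => m1 _.
by rewrite Psi_q_dmono ?(ltnW n_ge2) // mulrC.
Qed.

Lemma b2_B2S (m2 : mon 2 n.-1) : (2 <= n)%N ->
  b2 (B2S n m2)
  = \sum_(m1 : mon 2 n.-1) beta3 (mono n.-1 m2) (mono n.-1 m1) *: B1D n m1
    + \sum_(m1 : mon 2 n) beta2 (mono n.-1 m2) (dmono n m1) *: B1S n m1
    + (ry n * delta n) *: B1S n (U_(jz) + m2)%MM
    - (rz n * delta n) *: B1S n (U_(jy) + m2)%MM.
Proof.
move=> n_ge2; have n_gt0 := ltnW n_ge2.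
apply: etrans (dualB2E (bform_linearr _)) _; rewrite -!addrA; congr (_ + _).
  by apply: eq_bigr => m1 _; congr (_ *: _); exact: bform_SS.
have deg_m2 j : mdeg (U_(j) + m2)%MM = n by rewrite mdegD mdeg1 mon_deg; lia.
rewrite -(sum_mon_delta (B1S n) (deg_m2 jz)) -(sum_mon_delta (B1S n) (deg_m2 jy)).
rewrite !scaler_sumr -sumrB -big_split; apply: eq_bigr => m1 _ /=.
rewrite !scalerA -scalerBl -scalerDl; congr (_ *: _).
apply: etrans (bform_SD _ _) _; rewrite addrA.
by apply: (congr2 (fun a b => _ + _ * a - _ * b)); exact: evar_mono.
Qed.

Lemma b2_B2D (m2 : mon 2 n) : (0 < n)%N ->
  b2 (B2D n m2)
  = \sum_(M : mon 2 n.-1)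
      - (beta2 (mono n.-1 M) (dmono n m2)
         + ry n * delta n * (U_(jz) + M == m2 :> 'X_{1..2})%MM%:R
         - rz n * delta n * (U_(jy) + M == m2 :> 'X_{1..2})%MM%:R) *: B1D n M
    + \sum_(m1 : mon 2 n) beta1 (dmono n m2) (dmono n m1) *: B1S n m1.
Proof.
move=> n_gt0; apply: etrans (dualB2E (bform_linearr _)) _; congr (_ + _).
  apply: eq_bigr => M _; congr (_ *: _).
  apply: etrans (bform_skew _ _) _; congr (- _).
  apply: etrans (bform_SD _ _) _.
  by apply: (congr2 (fun a b => _ + _ * a - _ * b)); exact: evar_mono.
by apply: eq_bigr => m1 _; congr (_ *: _); exact: bform_DD.
Qed.

(** The part of [b2] of a dual monomial m2^* in the span of the M^* is the difference
   of two sums of this shape, for (j, i, a) = (z, y, y delta) and (y, z, z delta). *)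
Lemma sum_B1D_part (j : 'I_2) (i : 'I_3) (a : R) (m2 : mon 2 n) : (2 <= n)%N ->
  \sum_(M : mon 2 n.-1)
    (\sum_(m' : mon 3 n.-2)
        rx n * (chi n (U_(j) <= m2)%MM
                * Q n (mnmwiden (m2 - U_(j))%MM) (U_(ix) + m')%MM
                * t n (m' + mnmwiden M + U_(i))%MM)
     - a * (U_(j) + M == m2 :> 'X_{1..2})%MM%:R) *: B1D n M
  = chi n (U_(j) <= m2)%MM
      *: (\sum_(m' : mon 3 n.-2) \sum_(M : mon 2 n.-1)
            (rx n * t n (U_(i) + mnmwiden M + m')%MM
             * Q n (U_(ix) + m')%MM (mnmwiden (m2 - U_(j))%MM)) *: B1D n M
          - a *: B1D n (m2 - U_(j))%MM).
Proof.
move=> n_ge2; have n_gt0 := ltnW n_ge2.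
rewrite scalerBr scalerA [chi _ _ * a]mulrC -scalerA.
rewrite -(sum_mon_var_delta _ _ (B1D n)) // exchange_big /= !scaler_sumr.
rewrite -sumrB; apply: eq_bigr => M _ /=; rewrite scalerA scalerBl; congr (_ - _).
rewrite scaler_suml scaler_sumr; apply: eq_bigr => m' _; rewrite scalerA; congr (_ *: _).
have -> : (U_(i) + mnmwiden M + m' = m' + mnmwiden M + U_(i))%MM.
  by apply/mnmP => k; rewrite !mnmDE; lia.
rewrite (Q_sym (mnmwiden _) _ n_gt0).
have alg (x c a' b : R) : x * (c * a' * b) = c * (x * b * a') by ring.
exact: alg.
Qed.

Lemma sum_B1D_b2_dmono (m2 : mon 2 n) : (2 <= n)%N ->
  \sum_(M : mon 2 n.-1)
      - (beta2 (mono n.-1 M) (dmono n m2)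
         + ry n * delta n * (U_(jz) + M == m2 :> 'X_{1..2})%MM%:R
         - rz n * delta n * (U_(jy) + M == m2 :> 'X_{1..2})%MM%:R) *: B1D n M
  = chi n (U_(jz) <= m2)%MM
      *: (\sum_(m' : mon 3 n.-2) \sum_(M : mon 2 n.-1)
            (rx n * t n (U_(iy) + mnmwiden M + m')%MM
             * Q n (U_(ix) + m')%MM (mnmwiden (m2 - U_(jz))%MM)) *: B1D n M
          - (ry n * delta n) *: B1D n (m2 - U_(jz))%MM)
    - chi n (U_(jy) <= m2)%MM
      *: (\sum_(m' : mon 3 n.-2) \sum_(M : mon 2 n.-1)
            (rx n * t n (U_(iz) + mnmwiden M + m')%MM
             * Q n (U_(ix) + m')%MM (mnmwiden (m2 - U_(jy))%MM)) *: B1D n M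
          - (rz n * delta n) *: B1D n (m2 - U_(jy))%MM).
Proof.
move=> n_ge2; rewrite -!sum_B1D_part // -sumrB; apply: eq_bigr => M _.
rewrite -scalerBl beta2_mono //; congr (_ *: _).
(* The signs come from exchanging the two arguments of the alternating form. *)
have alg (a b c d : R) : - (a - b + c - d) = b - c - (a - d) by ring.
rewrite -alg; congr (- (_ + _ - _)).
by rewrite -sumrB; apply: eq_bigr => m' _; exact: mulrBr.
Qed.

Lemma sum_B1S_b2_dmono (m2 : mon 2 n) : (2 <= n)%N ->
  \sum_(m1 : mon 2 n) beta1 (dmono n m2) (dmono n m1) *: B1S n m1
  = chi n (U_(jz) <= m2)%MM
      *: (\sum_(M : mon 2 n.-1)
            (rx n * Q n (mnmwiden M) (mnmwiden (m2 - U_(jz))%MM)) *: B1S n (U_(jy) + M)%MM)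
    - chi n (U_(jy) <= m2)%MM
      *: (\sum_(M : mon 2 n.-1)
            (rx n * Q n (mnmwiden M) (mnmwiden (m2 - U_(jy))%MM)) *: B1S n (U_(jz) + M)%MM).
Proof.
move=> n_ge2; have n_gt0 := ltnW n_ge2.
rewrite -(sum_mon_chi jy (fun M => rx n * Q n (mnmwiden M) _) _ n_gt0).
rewrite -(sum_mon_chi jz (fun M => rx n * Q n (mnmwiden M) _) _ n_gt0).
rewrite !scaler_sumr -sumrB; apply: eq_bigr => m1 _.
by rewrite !scalerA -scalerBl beta1_mono.
Qed.

End Basis.

Theorem proposition5p5 (n : nat) (hn : (2 <= n)%N) :
  [/\ (* (1) *)
      (forall m : mon 2 n.-1,
         b1 (B1D n m) = rx n * lambda (mnmwiden m)),
      (forall m : mon 2 n,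
         b1 (B1S n m)
         = delta n * Psi 'X_[mnmwiden m]
           - rx n * \sum_(m1 : mon 3 n.-2)
               lambda (U_(ix) + m1)%MM * t n (m1 + mnmwiden m)%MM),
      (* (2)(a) *)
      (forall m2 : mon 2 n.-1,
         b2 (B2S n m2)
         = \sum_(m1 : mon 2 n.-1) \sum_(M1 : mon 3 n.-2) \sum_(M2 : mon 3 n.-2)
             (rx n * Q n (U_(ix) + M1)%MM (U_(ix) + M2)%MM
              * \det (mx22 (t n (mnmwiden m1 + M1 + U_(iy))%MM)
                           (t n (mnmwiden m1 + M1 + U_(iz))%MM)
                           (t n (mnmwiden m2 + M2 + U_(iy))%MM)
                           (t n (mnmwiden m2 + M2 + U_(iz))%MM)))
             *: B1D n m1
           + \sum_(m1 : mon 2 n) \sum_(M : mon 3 n.-2)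
               (rx n
                * (chi n (U_(jy) <= m1)%MM
                   * Q n (mnmwiden (m1 - U_(jy))%MM) (U_(ix) + M)%MM
                   * t n (M + mnmwiden m2 + U_(iz))%MM
                   - chi n (U_(jz) <= m1)%MM
                     * Q n (mnmwiden (m1 - U_(jz))%MM) (U_(ix) + M)%MM
                     * t n (M + mnmwiden m2 + U_(iy))%MM))
               *: B1S n m1
           + (ry n * delta n) *: B1S n (U_(jz) + m2)%MM
           - (rz n * delta n) *: B1S n (U_(jy) + m2)%MM),
      (* (2)(b) *)
      (forall m2 : mon 2 n,
         b2 (B2D n m2)
         = chi n (U_(jz) <= m2)%MM
           *: (\sum_(m' : mon 3 n.-2) \sum_(M : mon 2 n.-1)
                 (rx n * t n (U_(iy) + mnmwiden M + m')%MM
                  * Q n (U_(ix) + m')%MM (mnmwiden (m2 - U_(jz))%MM))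
                 *: B1D n M
               - (ry n * delta n) *: B1D n (m2 - U_(jz))%MM
               + \sum_(M : mon 2 n.-1)
                   (rx n * Q n (mnmwiden M) (mnmwiden (m2 - U_(jz))%MM))
                   *: B1S n (U_(jy) + M)%MM)
           - chi n (U_(jy) <= m2)%MM
             *: (\sum_(m' : mon 3 n.-2) \sum_(M : mon 2 n.-1)
                   (rx n * t n (U_(iz) + mnmwiden M + m')%MM
                    * Q n (U_(ix) + m')%MM (mnmwiden (m2 - U_(jy))%MM))
                   *: B1D n M
                 - (rz n * delta n) *: B1D n (m2 - U_(jy))%MM
                 + \sum_(M : mon 2 n.-1)
                     (rx n * Q n (mnmwiden M) (mnmwiden (m2 - U_(jy))%MM))
                     *: B1S n (U_(jz) + M)%MM)) &
      (* (3) *)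
      b3 (1 : Rn n)
      = \sum_(m : mon 2 n.-1) b1 (B1D n m) *: B2S n m
        + \sum_(m : mon 2 n) b1 (B1S n m) *: B2D n m].
Proof.
have n_gt0 := ltnW hn.
split.
- by move=> m; exact: b1_B1D.
- by move=> m; exact: b1_B1S.
- move=> m2; apply: etrans (b2_B2S m2 hn) _.
  apply: (congr2 (fun a b => a + b + _ - _)); apply: eq_bigr => m1 _.
    apply: etrans (congr1 (fun c => c *: _) (beta3_mono m2 m1 hn)) _.
    rewrite scaler_suml; apply: eq_bigr => M1 _; exact: scaler_suml.
  apply: etrans (congr1 (fun c => c *: _) (beta2_mono m2 m1 hn)) _.
  exact: scaler_suml.
- move=> m2; apply: etrans (b2_B2D m2 n_gt0) _.
  rewrite sum_B1D_b2_dmono // sum_B1S_b2_dmono //.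
  have regroup (V : lmodType (Rn n)) (c d : Rn n) (u v u' v' : V) :
      c *: u - d *: v + (c *: u' - d *: v') = c *: (u + u') - d *: (v + v').
    by rewrite addrACA -opprD -!scalerDr.
  exact: regroup.
- by rewrite /b3 scale1r; exact: (dualB1E (@b1_linear n)).
Qed.
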